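(* Let $G$ be a finite group with a series of normal subgroups $$1=G_0\unlhd G_1\unlhd\cdots\unlhd G_n\unlhd G_{n+1}=G,$$ and let $k$ be the number of indices $i\in\{1,2,\dots,n+1\}$ for which the factor $G_i/G_{i-1}$ is a non-trivial $p$-group. If $E_j$ is a simple $F[G/G_n]$-module, then $c_{jj}\ge k+1$, where $c_{jj}$ is the Cartan number of $G$ corresponding to $E_j$. In particular, if $G/G_n$ is a $p$-group, then $c_{11}\ge |G/G_n|+k-1$, where $c_{11}$ is the Cartan number of $G$ corresponding to the trivial module.
   Context: $F$ is a field of characteristic $p>0$ that is a splitting field for the groups considered. All $G_i$ are normal in $G$. A simple $F[G/G_n]$-module is regarded as a simple $F[G]$-module via inflation. The Cartan number of $G$ corresponding to a simple $F[G]$-module $E$ is the multiplicity of $E$ as a composition factor of the projective cover of $E$ over $F[G]$. *)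

(* Defs.v *)
From mathcomp Require Export all_boot all_order all_algebra all_fingroup.
From mathcomp Require Export all_solvable mxrepresentation.
From mathcomp Require Import boolp.

Set Implicit Arguments.
Unset Strict Implicit.
Unset Printing Implicit Defensive.

Import GroupScope GRing.Theory.
Local Open Scope ring_scope.

(* Finite-dimensional (equivalently, finitely generated) F[G]-modules are given
   as matrix representations acting on row vectors, v |-> v *m rV g. *)

Section Modules.

Variables (F : fieldType) (gT : finGroupType) (G : {group gT}).

Definition repr_hom (m1 m2 : nat) (rV : mx_representation F G m1)
    (rW : mx_representation F G m2) (f : 'M[F]_(m1, m2)) : Prop :=
  forall x, x \in G -> rV x *m f = f *m rW x.

(* The lifting property against epimorphisms of finitely generated modules.
   The map v |-> v *m f is onto exactly when f is row_full. *)
Definition projective_repr (m : nat) (rP : mx_representation F G m) : Prop :=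
  forall (m1 m2 : nat) (rV : mx_representation F G m1)
         (rW : mx_representation F G m2) (f : 'M[F]_(m1, m2))
         (h : 'M[F]_(m, m2)),
    repr_hom rV rW f -> row_full f -> repr_hom rP rW h ->
  exists2 l : 'M[F]_(m, m1), repr_hom rP rV l & l *m f = h.

(* An epimorphism from a projective module with superfluous kernel. *)
Definition projective_cover (m d : nat) (rP : mx_representation F G m)
    (rE : mx_representation F G d) (f : 'M[F]_(m, d)) : Prop :=
  [/\ projective_repr rP, repr_hom rP rE f, row_full f
    & forall U : 'M[F]_m, mxmodule rP U ->
        row_full (U + kermx f)%MS -> row_full U].

Definition composition_multiplicity (m d : nat)
    (rP : mx_representation F G m) (rE : mx_representation F G d)
    (U : seq 'M[F]_m) (compU : mx_composition_series rP U) : nat :=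
  #|[set i : 'I_(size U) | `[< mx_rsim (series_repr i compU) rE >] ]|.

(* "c is the Cartan number of G corresponding to rE".  A composition series U
   in the sense of mx_composition_series is one of the submodule last 0 U. *)
Definition is_cartan_number (d : nat) (rE : mx_representation F G d)
    (c : nat) : Prop :=
  exists (m : nat) (rP : mx_representation F G m) (f : 'M[F]_(m, d)),
    projective_cover rP rE f /\
    exists (U : seq 'M[F]_m) (compU : mx_composition_series rP U),
      (last 0 U :=: 1%:M)%MS /\ c = composition_multiplicity rE compU.

Lemma triv_mx_repr : mx_repr G (fun _ : gT => 1%:M : 'M[F]_1).
Proof. by split=> // x y _ _; rewrite mulmx1. Qed.

Definition triv_repr : mx_representation F G 1 :=
  MxRepresentation triv_mx_repr.

Section Inflation.

Variables (H : {group gT}) (nsHG : H <| G) (d : nat).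
Variable rE : mx_representation F (G / H)%G d.

Lemma infl_mx_repr : mx_repr G (fun x => rE (coset H x)).
Proof.
have nHG := subsetP (normal_norm nsHG).
split=> [|x y Gx Gy]; first by rewrite morph1 repr_mx1.
by rewrite morphM ?nHG // repr_mxM ?mem_quotient.
Qed.

Definition infl_repr : mx_representation F G d :=
  MxRepresentation infl_mx_repr.

End Inflation.

End Modules.

Arguments triv_repr F {gT} G.

(* The number of i in {1, ..., n + 1} such that Gs i / Gs (i - 1) is a
   non-trivial p-group. *)
Definition num_pfactors (p : nat) (gT : finGroupType)
    (Gs : nat -> {group gT}) (n : nat) : nat :=
  (\sum_(1 <= i < n.+2 |
      p.-group (Gs i / Gs i.-1)%g && ((Gs i / Gs i.-1)%g != 1%g)) 1)%N.

(* Main.v *)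
Require Import Defs.
From mathcomp Require Import mxabelem boolp.

(* For the projective cover P of E, the multiplicity of E in P is at least the
   dimension of End_G(P), because Hom_G(P, S) is one-dimensional if the simple
   module S is E and zero otherwise. So it suffices to exhibit enough linearly
   independent endomorphisms of P. Write s_i for the action on P of the sum of
   the elements of G_i. If G_i acts trivially on E then s_i is nonzero, and if
   moreover G_i / G_(i-1) is a nontrivial p-group then s_i, whose image lies in
   that of s_(i-1), lifts along s_(i-1) to an endomorphism psi_i of P with
   s_(i-1) o psi_i = s_i and s_i o psi_i = 0. The psi_i are independent of each
   other and of the identity. If Q = G / G_n is a p-group and E is trivial, P
   maps onto F[Q] and the identity can be replaced by lifts of a basis of
   End_Q(F[Q]), of size #|Q|. *)

Set Implicit Arguments.
Unset Strict Implicit.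
Unset Printing Implicit Defensive.

Import GRing.Theory.
Local Open Scope group_scope.
Local Open Scope ring_scope.

(** * Homomorphisms of matrix representations and Schur's lemma *)

Lemma repr_hom_mul (F : fieldType) (gT : finGroupType) (G : {group gT})
    (m1 m2 m3 : nat) (r1 : mx_representation F G m1)
    (r2 : mx_representation F G m2) (r3 : mx_representation F G m3) f g :
  repr_hom r1 r2 f -> repr_hom r2 r3 g -> repr_hom r1 r3 (f *m g).
Proof. by move=> hf hg x Gx; rewrite mulmxA hf // -!mulmxA hg. Qed.

Lemma repr_hom_sum (F : fieldType) (gT : finGroupType) (G : {group gT})
    (m1 m2 : nat) (r1 : mx_representation F G m1)
    (r2 : mx_representation F G m2) (I : Type) (s : seq I) (Q : pred I)
    (a : I -> F) (phi : I -> 'M_(m1, m2)) :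
  (forall i, Q i -> repr_hom r1 r2 (phi i)) ->
  repr_hom r1 r2 (\sum_(i <- s | Q i) a i *: phi i).
Proof.
move=> hphi x Gx; rewrite mulmx_sumr mulmx_suml; apply: eq_bigr => i Qi.
by rewrite -scalemxAr -scalemxAl hphi.
Qed.

Lemma mxmodule_ker_hom (F : fieldType) (gT : finGroupType) (G : {group gT})
    (m1 m2 : nat) (r1 : mx_representation F G m1)
    (r2 : mx_representation F G m2) f :
  repr_hom r1 r2 f -> mxmodule r1 (kermx f).
Proof.
move=> hf; apply/mxmoduleP=> x Gx; apply/sub_kermxP.
by rewrite -mulmxA hf // mulmxA mulmx_ker mul0mx.
Qed.

Lemma mxmodule_img_hom (F : fieldType) (gT : finGroupType) (G : {group gT})
    (m1 m2 : nat) (r1 : mx_representation F G m1)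
    (r2 : mx_representation F G m2) f m (U : 'M_(m, m1)) :
  repr_hom r1 r2 f -> mxmodule r1 U -> mxmodule r2 (U *m f).
Proof.
move=> hf modU; apply/mxmoduleP=> x Gx.
by rewrite -mulmxA -hf // mulmxA submxMr ?(mxmoduleP modU).
Qed.

Lemma Schur_rsim (F : fieldType) (gT : finGroupType) (G : {group gT})
    (m1 m2 : nat) (r1 : mx_representation F G m1)
    (r2 : mx_representation F G m2) f :
  mx_irreducible r1 -> mx_irreducible r2 -> repr_hom r1 r2 f -> f != 0 ->
  mx_rsim r1 r2.
Proof.
move=> /mx_irrP[m1_gt0 irr1] /mx_irrP[m2_gt0 irr2] hf nzf.
have ker0: kermx f == 0.
  apply: contraNT nzf => /(irr1 _ (mxmodule_ker_hom hf)).
  by rewrite -sub1mx => /sub_kermxP; rewrite mul1mx => ->.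
have freef: row_free f by rewrite -kermx_eq0.
have fullf: row_full f.
  rewrite /row_full -genmxE; apply: irr2.
    rewrite (eqmx_module _ (genmxE _)) -[f]mul1mx.
    exact: mxmodule_img_hom hf (mxmodule1 _).
  by rewrite -mxrank_eq0 genmxE mxrank_eq0.
by exists f; rewrite // -(eqP freef) (eqP fullf).
Qed.

(** * Maps from a projective cover to simple modules, and composition multiplicity *)

(** As [rS] is simple, [g] maps the kernel of [f] to zero or onto everything. In the second case the
    two kernels span the whole module and superfluity forces [g = 0]. Either way [g] kills the
    kernel of [f]. *)
Lemma hom_to_simple_factor (F : fieldType) (gT : finGroupType)
    (G : {group gT}) (m d s : nat) (rP : mx_representation F G m)
    (rE : mx_representation F G d) f (rS : mx_representation F G s) g :
  projective_cover rP rE f -> mx_irreducible rS -> repr_hom rP rS g ->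
  exists2 h, repr_hom rE rS h & g = f *m h.
Proof.
case=> _ hf fullf super /mx_irrP[_ irrS] hg.
have modKg := mxmodule_ker_hom hg; have modKf := mxmodule_ker_hom hf.
have ker_sub: kermx f *m g = 0.
  have [/(super _ modKg)|notfull] :=
    boolP (row_full (kermx g + kermx f)%MS).
    by rewrite -sub1mx => /sub_kermxP; rewrite mul1mx => ->; rewrite mulmx0.
  apply/eqP; rewrite -mxrank_eq0 -genmxE mxrank_eq0.
  apply: contraNT notfull => nzK.
  have: row_full <<kermx f *m g>>%MS.
    apply: irrS nzK; rewrite (eqmx_module _ (genmxE _)).
    exact: mxmodule_img_hom hg modKf.
  rewrite -sub1mx genmxE -sub1mx => /(submx_trans (submx1 g))/submxP[u gE].
  (* Since [g = u *m kermx f *m g], writing [1] as [(1 - u *m kermx f) + u *m kermx f] splits every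
     vector between the kernels of [g] and [f]. *)
  have /sub_kermxP: (1%:M - u *m kermx f) *m g = 0.
    by rewrite mulmxBl mul1mx -mulmxA -gE subrr.
  move=> sub1; rewrite -[1%:M](subrK (u *m kermx f)) addmx_sub_adds //.
  exact: submxMl.
have gE: g = f *m (pinvmx f *m g).
  apply/eqP; rewrite -subr_eq0 -{1}[g]mul1mx mulmxA -mulmxBl; apply/eqP.
  have /submxP[u ->]: (1%:M - f *m pinvmx f <= kermx f)%MS.
    by apply/sub_kermxP; rewrite mulmxBl mul1mx mulmxKpV ?subrr.
  by rewrite -mulmxA ker_sub mulmx0.
exists (pinvmx f *m g) => // x Gx.
apply: (row_full_inj fullf); rewrite (mulmxA f (rE x)) -hf //.
by rewrite -[LHS]mulmxA -gE hg // (mulmxA f _ (rS x)) -gE.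
Qed.

(* [Hom(P, S)] is at most one-dimensional by Schur's lemma. *)
Lemma rank_hom_to_simple (F : fieldType) (gT : finGroupType)
    (G : {group gT}) (m d s : nat) (rP : mx_representation F G m)
    (rE : mx_representation F G d) f (rS : mx_representation F G s)
    (r : nat) (A : 'M_(r, m * s)) :
  projective_cover rP rE f -> mx_absolutely_irreducible rE ->
  mx_irreducible rS ->
  (forall v : 'rV_(m * s), (v <= A)%MS -> repr_hom rP rS (vec_mx v)) ->
  (\rank A <= `[< mx_rsim rS rE >])%N.
Proof.
move=> covP absE irrS homA; have irrE := mx_abs_irrW absE.
have [->|nzA] := eqVneq A 0; first by rewrite mxrank0.
pose u := nz_row A; have nzu: u != 0 by rewrite /u nz_row_eq0.
have [h hh uE] := hom_to_simple_factor covP irrS (homA _ (nz_row_sub A)).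
have nzh: h != 0.
  apply: contraNneq nzu => h0.
  by rewrite -[u]vec_mxK uE h0 mulmx0 linear0.
have simES := Schur_rsim irrE irrS hh nzh.
rewrite (asboolT (mx_rsim_sym simES)).
apply: leq_trans (rank_leq_row u); apply: mxrankS; apply/row_subP=> i.
have [h' hh' vE] := hom_to_simple_factor covP irrS (homA _ (row_sub i A)).
have eds := mxrank_rsim simES; subst s.
have hu : h \in unitmx.
  case/mx_irrP: irrE => _ irr1.
  rewrite -row_free_unit -kermx_eq0.
  apply: contraNT nzh => /(irr1 _ (mxmodule_ker_hom hh)).
  by rewrite -sub1mx => /sub_kermxP; rewrite mul1mx => ->.
(* Two maps [h], [h'] from E to S differ by an endomorphism of E, which is a scalar by absolute
   irreducibility; so every row of [A] is a multiple of [u]. *)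
have /is_scalar_mxP[a aE]: is_scalar_mx (h' *m invmx h).
  apply: (mx_abs_irr_cent_scalar absE); apply/centgmxP => x Gx.
  have hV: invmx h *m rE x = rS x *m invmx h.
    by rewrite -[rE x](mulmxK hu) hh // -mulmxA mulKmx.
  by rewrite -mulmxA hV !mulmxA hh'.
have h'E : h' = a *: h.
  by rewrite -mul_scalar_mx -aE mulmxKV.
rewrite -[row i A]vec_mxK vE h'E -scalemxAr -uE linearZ /= vec_mxK.
exact: scalemx_sub.
Qed.

(** By induction on [j]: among maps into the [j]-th term of the series, composing with the
    projection to the top factor has as kernel the maps into the previous term, and as image a space
    of maps to a simple module. Rank-nullity adds the two bounds. *)
Lemma rank_endo_series (F : fieldType) (gT : finGroupType)
    (G : {group gT}) (m d : nat) (rP : mx_representation F G m)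
    (rE : mx_representation F G d) f
    (U : seq 'M_m) (compU : mx_composition_series rP U) (j r : nat)
    (A : 'M_(r, m * m)) :
  projective_cover rP rE f -> mx_absolutely_irreducible rE ->
  (j <= size U)%N ->
  (forall v : 'rV_(m * m), (v <= A)%MS ->
     repr_hom rP rP (vec_mx v) /\ (vec_mx v <= (0 :: U)`_j)%MS) ->
  (\rank A <= \sum_(0 <= i < j) `[< mx_rsim (series_repr i compU) rE >])%N.
Proof.
move=> covP absE; elim: j r A => [|j IHj] r A ltjU homA.
  rewrite big_geq // leqn0 mxrank_eq0 -submx0; apply/row_subP=> i.
  have [_] := homA _ (row_sub i A); rewrite /= submx0 => /eqP ri0.
  by rewrite -[row i A]vec_mxK ri0 linear0 sub0mx.
pose U0 := (0 :: U)`_j; pose U1 := U`_j.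
have modU0 : mxmodule rP U0 := mx_subseries_module' j (proj1 compU).
have modU1 : mxmodule rP U1 := mx_subseries_module j (proj1 compU).
pose W := <<in_factmod U0 U1>>%MS.
(* [B] is the quotient by [U0] followed by coordinates in [W]; it represents the projection to the
   factor only on matrices with rows in [U1]. *)
pose B := in_submod W (in_factmod U0 1%:M).
have BE (v : 'M_m) : v *m B = in_submod W (in_factmod U0 v).
  by rewrite /B in_submodE mulmxA -in_submodE -in_factmodE.
have subW (v : 'M_m) : (v <= U1)%MS -> (in_factmod U0 v <= W)%MS.
  by move=> sv; rewrite genmxE (in_factmodE U0 v) (in_factmodE U0 U1) submxMr.
rewrite big_nat_recr //= -(mxrank_mul_ker A (lin_mx (mulmxr B))) addnC.
apply: leq_add.
  apply: IHj (ltnW ltjU) _ => v; rewrite sub_capmx => /andP[vA /sub_kermxP].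
  rewrite mul_rV_lin /= => /eqP; rewrite mxvec_eq0 BE => /eqP v0.
  have [homv subv] := homA v vA; split=> //.
  by rewrite -in_factmod_eq0 -(in_submodK (subW _ subv)) v0 linear0.
apply: (rank_hom_to_simple covP absE); first exact: mx_series_repr_irr.
move=> w /submxP[c ->] x Gx; rewrite mulmxA.
have [homv subv] := homA (c *m A) (submxMl _ _).
rewrite (mul_rV_lin (mulmxr B)) mxvecK.
set v := vec_mx _ in homv subv *.
change (rP x *m (v *m B) = v *m B *m submod_mx (section_module modU0 modU1) x).
rewrite (mulmxA (rP x)) homv // !BE -in_submodJ ?subW //.
by rewrite in_factmodJ.
Qed.

(** The flattened [phi i] are the rows of a matrix of rank [#|I|] whose row space consists of
    endomorphisms, so the rank bound applies at the top of the series. *)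
Lemma indep_endo_leq_multiplicity (F : fieldType) (gT : finGroupType)
    (G : {group gT}) (m d : nat) (rP : mx_representation F G m)
    (rE : mx_representation F G d) f
    (U : seq 'M_m) (compU : mx_composition_series rP U)
    (I : finType) (phi : I -> 'M_m) :
  projective_cover rP rE f -> mx_absolutely_irreducible rE ->
  (last 0 U :=: 1%:M)%MS ->
  (forall i, repr_hom rP rP (phi i)) ->
  (forall a : I -> F, \sum_i a i *: phi i = 0 -> forall i, a i = 0) ->
  (#|I| <= composition_multiplicity rE compU)%N.
Proof.
move=> covP absE lastU homphi indep.
pose A : 'M_(#|I|, m * m) := \matrix_i mxvec (phi (enum_val i)).
have vecA (c : 'rV_#|I|) :
  vec_mx (c *m A) = \sum_i c 0 (enum_rank i) *: phi i.
  rewrite mulmx_sum_row linear_sum /= (reindex enum_rank) /=; last first.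
    by apply: onW_bij; apply: enum_rank_bij.
  by apply: eq_bigr => i _; rewrite linearZ /= rowK enum_rankK mxvecK.
have freeA : row_free A.
  rewrite -kermx_eq0; apply/rowV0P=> c /sub_kermxP cA0; apply/rowP=> i.
  have := vecA c; rewrite cA0 linear0 => /esym /indep /(_ (enum_val i)).
  by rewrite enum_valK mxE.
rewrite -(eqP freeA).
have := rank_endo_series compU covP absE (leqnn _) (A := A).
rewrite /composition_multiplicity -sum1dep_card big_mkord.
rewrite [in X in _ -> X]big_mkcond /=.
apply=> v /submxP[c ->]; split.
  by rewrite vecA; apply: repr_hom_sum.
by rewrite -(last_nth 0 0 U) lastU submx1.
Qed.

(** * Lifting through projective modules and the trace formula *)

(** Projectivity only lifts along epimorphisms, so both maps are first corestricted to the image of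
    [g]. *)
Lemma projective_lift_image (F : fieldType) (gT : finGroupType)
    (G : {group gT}) (m m1 m2 : nat) (rP : mx_representation F G m)
    (rV : mx_representation F G m1) (rW : mx_representation F G m2) g u :
  projective_repr rP -> repr_hom rV rW g -> repr_hom rP rW u ->
  (u <= g)%MS -> exists2 l, repr_hom rP rV l & l *m g = u.
Proof.
move=> projP hg hu sug; pose I := <<g>>%MS.
have modI : mxmodule rW I.
  rewrite (eqmx_module _ (genmxE _)) -[g]mul1mx.
  exact: mxmodule_img_hom hg (mxmodule1 _).
have sgI : (g <= I)%MS by rewrite genmxE.
have suI : (u <= I)%MS by rewrite genmxE.
have homI k (rX : mx_representation F G k) h : (h <= I)%MS ->
    repr_hom rX rW h -> repr_hom rX (submod_repr modI) (in_submod I h).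
  move=> shI hh x Gx; rewrite -[RHS]in_submodJ // -hh //.
  by rewrite in_submodE mulmxA -in_submodE.
have fullI : row_full (in_submod I g).
  by rewrite /row_full mxrank_in_submod // genmxE.
have [l hl lE] :=
  projP _ _ _ _ _ _ (homI _ _ _ sgI hg) fullI (homI _ _ _ suI hu).
exists l => //; rewrite -(in_submodK suI) -lE -{1}(in_submodK sgI).
by rewrite [RHS]val_submodE -mulmxA -val_submodE.
Qed.

Lemma regular_mx_aug (F : fieldType) (gT : finGroupType) (G : {group gT}) x :
  regular_repr F G x *m const_mx 1 = const_mx 1 :> 'cV_ _.
Proof.
apply/row_matrixP=> i; rewrite row_mul rowK -rowE.
by apply/rowP=> j; rewrite !mxE.
Qed.

(* Frobenius reciprocity for the free module F[G] (x) W: a lift of [g] to it is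
   determined by its coordinate [theta] at the identity of G. *)
Lemma projective_hom_trace (F : fieldType) (gT : finGroupType)
    (G : {group gT}) (m w : nat) (rP : mx_representation F G m)
    (rW : mx_representation F G w) g :
  projective_repr rP -> repr_hom rP rW g ->
  exists theta, g = \sum_(x in G) rP x^-1%g *m theta *m rW x.
Proof.
move=> projP hg; pose R := regular_repr F G; pose nG := gcard G.
(* Matrices with rows indexed by G model F[G] (x) W with the diagonal action of G. *)
pose act x : 'M_(nG * w) := lin_mx (mulmxr (rW x) \o mulmx (R x)^T).
have actE x v : v *m act x = mxvec ((R x)^T *m vec_mx v *m rW x).
  by rewrite mul_rV_lin.
have reprV : mx_repr G act.
  split=> [|x y Gx Gy]; apply/row_matrixP=> i; rewrite !rowE.
    by rewrite actE !repr_mx1 trmx1 mul1mx !mulmx1 vec_mxK.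
  by rewrite mulmxA !actE mxvecK !repr_mxM // trmx_mul !mulmxA.
pose rV := MxRepresentation reprV.
(* [e] adds up the rows: it is the augmentation of F[G] tensored with the identity of W. *)
pose e : 'M[F]_(nG * w, w) :=
  lin1_mx (mulmx (const_mx 1 : 'rV[F]_nG) \o vec_mx).
have eE v : v *m e = const_mx 1 *m vec_mx v by rewrite mul_rV_lin1.
have he : repr_hom rV rW e.
  move=> x Gx; apply/row_matrixP=> i; rewrite !rowE !mulmxA /=.
  rewrite actE !eE mxvecK !mulmxA; congr (_ *m _ *m _).
  by apply: trmx_inj; rewrite trmx_mul trmxK trmx_const regular_mx_aug.
have fulle : row_full e.
  rewrite -sub1mx; apply/row_subP=> i; apply/submxP.
  exists (mxvec (delta_mx (gring_index G 1%g) 0 *m row i 1%:M)).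
  rewrite eE mxvecK mulmxA; set u := row i _.
  rewrite [const_mx 1 *m _](_ : _ = 1%:M) ?mul1mx //.
  rewrite -colE; apply/matrixP=> a b.
  by rewrite !ord1 !mxE.
have [l hl lE] := projP _ _ _ _ _ _ he fulle hg.
pose i0 := gring_index G 1%g.
(* [c] reads the row at the identity. The row of [v *m l] at [x] is the identity row of its
   translate by [x^-1], moved back by [rW x]; summing over [x] gives the formula. *)
pose c : 'M[F]_(nG * w, w) := lin1_mx (row i0 \o @vec_mx F nG w).
exists (l *m c); apply/row_matrixP=> i; rewrite !rowE.
set v := delta_mx 0 i; rewrite -lE mulmxA eE mulmx_sumr.
rewrite mulmx_sum_row (reindex_onto (gring_index G) enum_val) /=; last first.
  by move=> j _; rewrite gring_valK.
apply: eq_big => [x|x].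
  apply/eqP/idP=> [<-|]; first exact: enum_valP.
  exact: gring_indexK.
move=> /eqP enumx; have Gx: x \in G by rewrite -enumx enum_valP.
rewrite mxE scale1r !mulmxA -(mulmxA v) hl ?groupV // mulmxA.
set u := v *m l; rewrite -[rV _]/(act _) actE.
rewrite [_ *m c]mul_rV_lin1 /= mxvecK !row_mul -!mulmxA -repr_mxM ?groupV //.
rewrite mulVg repr_mx1 mulmx1 [LHS]rowE; congr (_ *m _).
apply/rowP=> j; rewrite !mxE eqxx -2!(inj_eq enum_val_inj) /=.
rewrite !gring_indexK ?groupM ?groupV ?enum_valP // [1%g == _]eq_sym.
by rewrite -eq_mulgV1.
Qed.

(** * The maps s_i of normal subgroups and the endomorphisms psi_i *)

Definition repr_sum (F : fieldType) (gT : finGroupType) (G : {group gT})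
    (m : nat) (rP : mx_representation F G m) (A : {set gT}) : 'M_m :=
  \sum_(x in A) rP x.

Lemma sum_rcosets (V : nmodType) (gT : finGroupType) (H K : {group gT})
    (E : gT -> V) : H \subset K ->
  \sum_(x in K) E x =
    \sum_(C in rcosets H K) \sum_(h in H) E (h * repr C)%g.
Proof.
move=> sHK.
rewrite (set_partition_big _ (rcosets_partition sHK)) /=.
apply: eq_bigr => C /rcosetsP[x Kx ->].
rewrite -{1}rcoset_repr -(rcosetE _ (repr _)).
by rewrite big_imset //= => y z _ _ /mulIg.
Qed.

Lemma repr_sum_hom (F : fieldType) (gT : finGroupType) (G H : {group gT})
    (m : nat) (rP : mx_representation F G m) :
  H <| G -> repr_hom rP rP (repr_sum rP H).
Proof.
move=> /andP[sHG nHG] x Gx; rewrite mulmx_sumr mulmx_suml.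
rewrite (reindex_inj (conjg_inj x)) /=.
apply: eq_big => [y|y Hxy]; first by rewrite memJ_norm ?(subsetP nHG).
have Gy : y \in G by rewrite -(groupJr _ Gx) (subsetP sHG).
by rewrite -!repr_mxM ?groupJ // -conjgC.
Qed.

Lemma repr_sum_mulr (F : fieldType) (gT : finGroupType) (G H : {group gT})
    (m : nat) (rP : mx_representation F G m) y :
  H \subset G -> y \in H -> repr_sum rP H *m rP y = repr_sum rP H.
Proof.
move=> sHG Hy; rewrite mulmx_suml [RHS](reindex_inj (mulIg y)) /=.
apply: eq_big => [x|x Hx]; first by rewrite groupMr.
by rewrite repr_mxM ?(subsetP sHG).
Qed.

(** In the trace formula write [x = h * y] with [y] a coset representative: [rW h] is trivial, so
    the sum over [h] only affects the left factor, where it becomes [repr_sum rP H] and commutes to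
    the front. *)
Lemma repr_sum_factor (F : fieldType) (gT : finGroupType) (G H : {group gT})
    (m w : nat) (rP : mx_representation F G m) (rW : mx_representation F G w)
    g :
  H <| G -> projective_repr rP -> repr_hom rP rW g ->
  (forall x, x \in H -> rW x = 1%:M) -> exists Y, g = repr_sum rP H *m Y.
Proof.
move=> nsHG projP hg trivH; have sHG := normal_sub nsHG.
have [theta ->] := projective_hom_trace projP hg.
exists (\sum_(C in rcosets H G) rP (repr C)^-1%g *m theta *m rW (repr C)).
rewrite (sum_rcosets _ sHG) mulmx_sumr; apply: eq_bigr => C.
case/rcosetsP=> x Gx ->; set y := repr _.
have Gy : y \in G.
  by apply: (subsetP _ _ (mem_repr_rcoset H x)); rewrite mul_subG ?sub1set.
rewrite !mulmxA -(repr_sum_hom rP nsHG) ?groupV // mulmx_sumr !mulmx_suml.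
rewrite (reindex_inj invg_inj) /=; apply: eq_big => [h|h Hh].
  by rewrite groupV.
have Gh : h \in G by rewrite -groupV (subsetP sHG).
by rewrite invMg invgK !repr_mxM ?groupV // (trivH h^-1%g) // mul1mx.
Qed.

(** [S] is the sum over representatives of the right cosets of H in M. It can stand on either side
    because H is normal in G, and the sum over M absorbs each of its [#|M : H|] terms. *)
Lemma repr_sum_transversal (F : fieldType) (gT : finGroupType)
    (G H M : {group gT}) (m : nat) (rP : mx_representation F G m) :
  H <| G -> M \subset G -> H \subset M ->
  exists S, [/\ repr_sum rP M = repr_sum rP H *m S,
    repr_sum rP M = S *m repr_sum rP H &
    repr_sum rP M *m S = #|M : H|%:R *: repr_sum rP M].
Proof.
move=> nsHG sMG sHM; pose S := \sum_(C in rcosets H M) rP (repr C).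
have reprM C : C \in rcosets H M -> repr C \in M.
  case/rcosetsP=> x Mx ->.
  by apply: (subsetP _ _ (mem_repr_rcoset H x)); rewrite mul_subG ?sub1set.
have HS : repr_sum rP M = repr_sum rP H *m S.
  rewrite [LHS](sum_rcosets _ sHM) mulmx_sumr; apply: eq_bigr => C /reprM MC.
  rewrite mulmx_suml; apply: eq_bigr => h Hh.
  by rewrite repr_mxM // (subsetP sMG) // (subsetP sHM).
exists S; split=> //.
  rewrite HS mulmx_sumr mulmx_suml; apply: eq_bigr => C /reprM MC.
  by rewrite (repr_sum_hom rP nsHG) // (subsetP sMG).
rewrite mulmx_sumr (eq_bigr (fun=> repr_sum rP M)) => [|C /reprM MC].
  by rewrite sumr_const scaler_nat.
exact: repr_sum_mulr.
Qed.

(* The endomorphism of [P] induced by the norm of [M / H], which is nilpotent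
   because its square is [#|M : H|] times itself. *)
Lemma pfactor_endo (F : fieldType) (p : nat) (gT : finGroupType)
    (G H M : {group gT}) (m : nat) (rP : mx_representation F G m) :
  p \in [pchar F] -> projective_repr rP -> H <| G -> M <| G -> H \subset M ->
  p.-group (M / H)%g -> (M / H)%g != 1%g ->
  exists psi, [/\ repr_hom rP rP psi,
    psi *m repr_sum rP H = repr_sum rP M & psi *m repr_sum rP M = 0].
Proof.
move=> charFp projP nsHG nsMG sHM pMH ntMH.
have [S [HS SH MS]] := repr_sum_transversal rP nsHG (normal_sub nsMG) sHM.
have sMH : (repr_sum rP M <= repr_sum rP H)%MS by rewrite SH submxMl.
have [psi hpsi psiE] := projective_lift_image projP (repr_sum_hom rP nsHG)
  (repr_sum_hom rP nsMG) sMH.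
(* The product [psi *m repr_sum rP M] equals [repr_sum rP M *m S], a multiple of [repr_sum rP M] by
   the index, which p divides. *)
exists psi; split=> //; rewrite HS mulmxA psiE MS.
have [_ p_dvd _] := pgroup_pdiv pMH ntMH.
have nHM : M \subset 'N(H) := subset_trans (normal_sub nsMG) (normal_norm nsHG).
move: p_dvd; rewrite card_quotient // (dvdn_pcharf charFp) => /eqP ->.
by rewrite scale0r.
Qed.

(** * Independence of the psi_i along the series *)

(** Each psi_i is killed by s_N, hence by [l]. Multiplying a linear relation by [l] therefore
    isolates the [tau k], whose coefficients vanish by hypothesis; those of the psi_i are then
    removed one at a time from the top. *)
Lemma multiplicity_ge_pfactors_add (F : fieldType) (p : nat)
    (gT : finGroupType) (G : {group gT}) (m d w : nat)
    (rP : mx_representation F G m) (rE : mx_representation F G d) f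
    (U : seq 'M_m) (compU : mx_composition_series rP U)
    (N : nat) (Gs : nat -> {group gT})
    (K : finType) (tau : K -> 'M_m) (l Y : 'M_(m, w)) :
  p \in [pchar F] -> projective_cover rP rE f ->
  mx_absolutely_irreducible rE -> (last 0 U :=: 1%:M)%MS ->
  (forall i, (i <= N)%N -> Gs i <| G) ->
  (forall i, (i < N)%N -> Gs i \subset Gs i.+1) ->
  repr_sum rP (Gs N) != 0 -> l = repr_sum rP (Gs N) *m Y ->
  (forall k, repr_hom rP rP (tau k)) ->
  (forall b : K -> F, \sum_k b k *: (tau k *m l) = 0 -> forall k, b k = 0) ->
  (\sum_(i < N | p.-group (Gs i.+1 / Gs i) && ((Gs i.+1 / Gs i)%g != 1%g)) 1
    + #|K| <= composition_multiplicity rE compU)%N.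
Proof.
move=> charFp covP absE lastU nsG sG nzN lE homtau indep.
have [projP _ _ _] := covP.
pose Q (i : 'I_N) :=
  p.-group (Gs i.+1 / Gs i) && ((Gs i.+1 / Gs i)%g != 1%g).
have sGs i j : (i <= j)%N -> (j <= N)%N -> Gs i \subset Gs j.
  elim: j => [|j IHj]; first by rewrite leqn0 => /eqP->.
  rewrite leq_eqVlt => /predU1P[-> //|lij] ljN.
  exact: subset_trans (IHj lij (ltnW ljN)) (sG _ ljN).
have [psi psiP] := choice (fun i : {i : 'I_N | Q i} =>
  pfactor_endo charFp projP (nsG _ (ltnW (ltn_ord (val i))))
    (nsG _ (ltn_ord (val i))) (sG _ (ltn_ord (val i)))
    (proj1 (andP (valP i))) (proj2 (andP (valP i)))).
have psi0 (i : {i : 'I_N | Q i}) j : (val i < j)%N -> (j <= N)%N ->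
    psi i *m repr_sum rP (Gs j) = 0.
  move=> lij ljN; have [_ _ psi0] := psiP i.
  have [S [-> _ _]] := repr_sum_transversal rP
    (nsG _ (ltn_ord (val i))) (normal_sub (nsG _ ljN)) (sGs _ _ lij ljN).
  by rewrite mulmxA psi0 mul0mx.
(* Nonvanishing passes down the series, since s_N factors through every s_j. *)
have nz j : (j <= N)%N -> repr_sum rP (Gs j) != 0.
  move=> ljN; apply: contraNneq nzN => j0.
  have [S [-> _ _]] := repr_sum_transversal rP
    (nsG _ ljN) (normal_sub (nsG _ (leqnn N))) (sGs _ _ ljN (leqnn N)).
  by rewrite j0 mul0mx.
pose phi (x : {i : 'I_N | Q i} + K) :=
  match x with inl i => psi i | inr k => tau k end.
rewrite (_ : (\sum_(i < N | _) 1)%N = #|{: {i : 'I_N | Q i}}|); last first.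
  by rewrite card_sig sum1_card.
rewrite -card_sum.
apply: (indep_endo_leq_multiplicity compU (phi := phi) covP absE lastU).
  by case=> [i|k] /=; [case: (psiP i) | ].
move=> a; rewrite big_sumType /= => a0.
have b0 k : a (inr k) = 0.
  apply: (indep (fun k => a (inr k))).
  have := congr1 (mulmx^~ l) a0; rewrite /= mul0mx mulmxDl => a0l.
  apply: etrans _ a0l.
  rewrite [X in X + _]mulmx_suml [X in X + _]big1 ?add0r => [|i _].
    by rewrite mulmx_suml; apply: eq_bigr => j _; rewrite scalemxAl.
  by rewrite -scalemxAl lE mulmxA psi0 // mul0mx scaler0.
case=> [i|k]; last exact: b0.
move: a0; rewrite [X in _ + X]big1 ?addr0 => [a0|k _]; last first.
  by rewrite b0 scale0r.
(* Downward induction on [val i]. Multiplying by the s of index [val i] kills psi_j for [j] below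
   [i], while the coefficients above [i] are already zero; what remains is [a (inl i)] times the
   nonzero s of index [(val i).+1]. *)
have [r] := ubnP (N - val i); elim: r i => // r IHr i le_r.
have := congr1 (mulmx^~ (repr_sum rP (Gs (val i)))) a0.
rewrite /= mul0mx mulmx_suml (bigD1 i) //= big1 ?addr0 => [|j nji].
  rewrite -scalemxAl; have [_ -> _] := psiP i => /eqP.
  by rewrite scalemx_eq0 (negPf (nz _ _)) ?orbF // => /eqP.
rewrite -scalemxAl; have [lij|] := ltnP (val i) (val j).
  rewrite IHr ?scale0r //; rewrite ltnS in le_r.
  by apply: leq_trans le_r; rewrite ltn_sub2l.
rewrite leq_eqVlt => /predU1P[eji|lji].
  by case/eqP: nji; apply/val_inj/val_inj.
by rewrite psi0 ?scaler0 // ltnW.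
Qed.

(** * Endomorphisms of the regular module *)

(** This is left multiplication by [v] on F[G], the endomorphism that sends the identity to [v]. *)
Definition regular_endo (F : fieldType) (gT : finGroupType) (G : {group gT})
    (v : 'rV[F]_(gcard G)) : 'M_(gcard G) :=
  \matrix_i (v *m regular_repr F G (enum_val i)).

Lemma row_regular_endo (F : fieldType) (gT : finGroupType) (G : {group gT})
    (v : 'rV[F]_(gcard G)) x :
  x \in G -> row (gring_index G x) (regular_endo v) = v *m regular_repr F G x.
Proof. by move=> Gx; rewrite rowK gring_indexK. Qed.

Lemma regular_endo_hom (F : fieldType) (gT : finGroupType) (G : {group gT})
    (v : 'rV[F]_(gcard G)) :
  repr_hom (regular_repr F G) (regular_repr F G) (regular_endo v).
Proof.
move=> x Gx; apply/row_matrixP=> i; rewrite !row_mul rowK -rowE.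
by rewrite row_regular_endo ?groupM ?enum_valP // rowK repr_mxM ?enum_valP //
  mulmxA.
Qed.

Lemma regular_endo_indep (F : fieldType) (gT : finGroupType) (G : {group gT})
    (b : 'I_(gcard G) -> F) :
  \sum_i b i *: regular_endo (delta_mx 0 i) = 0 -> forall i, b i = 0.
Proof.
move=> b0 i; have := congr1 (row (gring_index G 1%g)) b0.
rewrite linear_sum linear0 /= => /rowP/(_ i).
rewrite summxE (bigD1 i) //= big1 => [|j nji].
  rewrite linearZ /= row_regular_endo // repr_mx1 mulmx1 !mxE !eqxx mulr1.
  by rewrite addr0.
rewrite linearZ /= row_regular_endo // repr_mx1 mulmx1 !mxE eqxx /=.
by rewrite eq_sym (negPf nji) mulr0.
Qed.

(** Fixed vectors are multiples of the sum of all group elements, on which left multiplication by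
    [v] acts as the augmentation of [v]. *)
Lemma rfix_regular_endo (F : fieldType) (gT : finGroupType) (G : {group gT})
    (v c : 'rV[F]_(gcard G)) :
  (c <= rfix_mx (regular_repr F G) G)%MS ->
  c *m regular_endo v = (v *m (const_mx 1 : 'cV_(gcard G))) 0 0 *: c.
Proof.
rewrite rfix_regular => /sub_rVP[a ->].
set s := gring_row _.
have sE : s = \sum_(x in G) delta_mx 0 (gring_index G x).
  rewrite /s /gset_mx linear_sum; apply: eq_bigr => x Gx.
  by rewrite /= /gring_row rowK gring_indexK // mul1g.
have sumE : \sum_(x in G) regular_repr F G x = const_mx 1 *m s.
  apply/row_matrixP=> i; rewrite row_mul row_const linear_sum sE /=.
  rewrite [const_mx 1](_ : _ = 1%:M) ?mul1mx; last first.
    by apply/matrixP=> j k; rewrite !ord1 !mxE.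
  rewrite [RHS](reindex_inj (mulgI (enum_val i))).
  apply: eq_big => [x|x Gx]; last by rewrite rowK.
  by rewrite groupMl ?enum_valP.
rewrite -scalemxAl scalerA mulrC -scalerA; congr (_ *: _).
rewrite {1}sE mulmx_suml (eq_bigr (fun x => v *m regular_repr F G x)).
  by rewrite -mulmx_sumr sumE mulmxA {1}[v *m _]mx11_scalar mul_scalar_mx.
by move=> x Gx; rewrite -rowE row_regular_endo.
Qed.

(* Nakayama's lemma for the local ring F[G]: the kernel of the endomorphism
   defined by an element of nonzero augmentation has no fixed vectors. *)
Lemma regular_submod_full (F : fieldType) (p : nat) (gT : finGroupType)
    (G : {group gT}) (m : nat) (U : 'M_(m, gcard G)) :
  p \in [pchar F] -> p.-group G -> mxmodule (regular_repr F G) U ->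
  U *m (const_mx 1 : 'cV_(gcard G)) != 0 -> row_full U.
Proof.
move=> charFp pG modU nzU.
have [i nzi] : exists i, row i U *m (const_mx 1 : 'cV_(gcard G)) != 0.
  apply/existsP; apply: contraR nzU => /existsPn nzU; apply/eqP.
  apply/row_matrixP=> i; rewrite row_mul row0; apply/eqP.
  by move: (nzU i); rewrite negbK.
set v := row i U in nzi; pose Phi := regular_endo v.
have sPhiU : (Phi <= U)%MS.
  by apply/row_subP=> j; rewrite rowK mxmodule_trans ?enum_valP ?row_sub.
(* [Phi] is square, so injectivity makes it onto. A nonzero kernel would contain a nonzero vector
   fixed by the p-group, on which [Phi] acts as the nonzero augmentation of [v]. *)
suffices freePhi : kermx Phi == 0.
  rewrite -sub1mx; apply: submx_trans sPhiU.
  by rewrite sub1mx row_full_unit -row_free_unit -kermx_eq0.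
have modK := mxmodule_ker_hom (regular_endo_hom v).
apply/negPn/negP => nzK.
have: rfix_mx (submod_repr modK) G != 0.
  by rewrite (rfix_pgroup_pchar charFp) // lt0n mxrank_eq0.
case/rowV0Pn=> z zfix; rewrite -(val_submod_eq0) => nzz.
set c := val_submod z in nzz.
have cfix : (c <= rfix_mx (regular_repr F G) G)%MS.
  apply/rfix_mxP=> x Gx; rewrite -(val_submodJ modK) //.
  by move/rfix_mxP: zfix => /(_ x Gx) ->.
have /sub_kermxP : (c <= kermx Phi)%MS by apply: val_submodP.
rewrite rfix_regular_endo // => /eqP; rewrite scalemx_eq0 (negPf nzz) orbF.
move=> /eqP v0; case/eqP: nzi.
by rewrite [LHS]mx11_scalar v0 raddf0.
Qed.

(** * The two lower bounds and the theorem *)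

Lemma infl_repr_irr (F : fieldType) (gT : finGroupType) (G H : {group gT})
    (nsHG : H <| G) (d : nat) (rE : mx_representation F (G / H)%G d) :
  mx_irreducible rE -> mx_irreducible (infl_repr nsHG rE).
Proof.
case/mx_irrP=> d_gt0 irrE; apply/mx_irrP; split=> // U modU; apply: irrE.
apply/mxmoduleP=> _ /morphimP[x Nx Gx ->].
exact: (mxmoduleP modU).
Qed.

(** The identity serves as the single extra endomorphism, with [l] equal to s_N. The latter is
    nonzero because [f] factors through it. *)
Lemma multiplicity_ge_pfactors (F : fieldType) (p : nat)
    (gT : finGroupType) (G : {group gT}) (m d : nat)
    (rP : mx_representation F G m) (rE : mx_representation F G d) f
    (U : seq 'M_m) (compU : mx_composition_series rP U)
    (N : nat) (Gs : nat -> {group gT}) :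
  p \in [pchar F] -> projective_cover rP rE f ->
  mx_absolutely_irreducible rE -> (last 0 U :=: 1%:M)%MS ->
  (forall i, (i <= N)%N -> Gs i <| G) ->
  (forall i, (i < N)%N -> Gs i \subset Gs i.+1) ->
  (forall x, x \in Gs N -> rE x = 1%:M) ->
  (\sum_(i < N | p.-group (Gs i.+1 / Gs i) && ((Gs i.+1 / Gs i)%g != 1%g)) 1
    + 1 <= composition_multiplicity rE compU)%N.
Proof.
move=> charFp covP absE lastU nsG sG trivE.
have [projP hf fullf _] := covP.
have nzN : repr_sum rP (Gs N) != 0.
  have [Y fE] := repr_sum_factor (nsG N (leqnn N)) projP hf trivE.
  have [d_gt0 _] := andP absE.
  apply: contraTneq d_gt0 => N0; move: fullf.
  by rewrite fE N0 mul0mx /row_full mxrank0 => /eqP <-.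
have := multiplicity_ge_pfactors_add compU (K := unit) (tau := fun=> 1%:M)
  charFp covP absE lastU nsG sG nzN (esym (mulmx1 _)).
rewrite card_unit; apply=> [_ x Gx|b]; first by rewrite mulmx1 mul1mx.
rewrite (bigD1 tt) //= big1 ?addr0 => [/eqP|[]] //.
by rewrite mul1mx scalemx_eq0 (negPf nzN) orbF => /eqP b0 [].
Qed.

(** Lifting [f] along the augmentation of F[Q] gives [l] from P to F[Q]. Its image has nonzero
    augmentation, hence is all of F[Q], so the endomorphisms of F[Q] lift along [l] to the family
    [tau]. *)
Lemma multiplicity_triv_ge (F : fieldType) (p : nat)
    (gT : finGroupType) (G : {group gT}) (m : nat)
    (rP : mx_representation F G m) f
    (U : seq 'M_m) (compU : mx_composition_series rP U)
    (N : nat) (Gs : nat -> {group gT}) :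
  p \in [pchar F] -> projective_cover rP (triv_repr F G) f ->
  (last 0 U :=: 1%:M)%MS ->
  (forall i, (i <= N)%N -> Gs i <| G) ->
  (forall i, (i < N)%N -> Gs i \subset Gs i.+1) ->
  p.-group (G / Gs N) ->
  (\sum_(i < N | p.-group (Gs i.+1 / Gs i) && ((Gs i.+1 / Gs i)%g != 1%g)) 1
    + #|(G / Gs N)%g| <= composition_multiplicity (triv_repr F G) compU)%N.
Proof.
move=> charFp covP lastU nsG sG pQ; have nsN := nsG N (leqnn N).
have absE : mx_absolutely_irreducible (triv_repr F G).
  exact: linear_mx_abs_irr.
have [projP hf fullf _] := covP.
pose Q := (G / Gs N)%G; pose R := regular_repr F Q.
pose W := infl_repr nsN R.
pose aug : 'cV[F]_(gcard Q) := const_mx 1.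
have haug : repr_hom W (triv_repr F G) aug.
  by move=> x Gx; rewrite mulmx1 [W x *m _]regular_mx_aug.
have nzf : f != 0.
  by apply: contraTneq fullf => ->; rewrite /row_full mxrank0.
have fullaug : row_full aug.
  rewrite /row_full eqn_leq rank_leq_col lt0n mxrank_eq0.
  apply: contraNneq (oner_neq0 F) => /matrixP/(_ (gring_index Q 1%g) 0).
  by rewrite !mxE => ->.
have [l hl lE] := projP _ _ _ _ _ _ haug fullaug hf.
have modl : mxmodule R l.
  apply/mxmoduleP=> _ /morphimP[x Nx Gx ->].
  by rewrite -[R _]/(W x) -hl // submxMl.
have fulll : row_full l.
  by apply: regular_submod_full charFp pQ modl _; rewrite lE.
have hendo i : repr_hom W W (regular_endo (delta_mx 0 i)).
  by move=> x Gx; apply: regular_endo_hom; apply: mem_quotient.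
(* The [let:] only turns the [exists2] of projectivity into the plain existential that [choice]
   expects. *)
have [tau tauP] := choice (fun i : 'I_(gcard Q) =>
  let: ex_intro2 t ht tE := projP _ _ _ _ _ _ hl fulll
    (repr_hom_mul hl (hendo i)) in ex_intro
    (fun t => repr_hom rP rP t /\ t *m l = l *m regular_endo (delta_mx 0 i))
    t (conj ht tE)).
have trivW x : x \in Gs N -> W x = 1%:M.
  by move=> Nx; rewrite /W /= coset_id // repr_mx1.
have [Y lY] := repr_sum_factor nsN projP hl trivW.
have nzN : repr_sum rP (Gs N) != 0.
  by apply: contraNneq nzf => N0; rewrite -lE lY N0 !mul0mx.
have := multiplicity_ge_pfactors_add compU charFp covP absE lastU nsG sG nzN
  lY (fun i => proj1 (tauP i)).
rewrite card_ord; apply=> b b0; apply: regular_endo_indep.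
apply: (row_full_inj fulll); rewrite mulmx0 -[RHS]b0 mulmx_sumr.
by apply: eq_bigr => i _; rewrite -scalemxAr (proj2 (tauP i)).
Qed.

Lemma num_pfactorsE (p : nat) (gT : finGroupType) (Gs : nat -> {group gT})
    (n : nat) :
  num_pfactors p Gs n =
    (\sum_(i < n.+1 |
        p.-group (Gs i.+1 / Gs i) && ((Gs i.+1 / Gs i)%g != 1%g)) 1)%N.
Proof. by rewrite /num_pfactors big_add1 big_mkord. Qed.

Local Close Scope ring_scope.
Local Close Scope group_scope.

Theorem theorem5p7 (F : fieldType) (p : nat) (charFp : p \in [pchar F]%R)
    (gT : finGroupType) (G : {group gT})
    (splitG : group_splitting_field F G)
    (n : nat) (Gs : nat -> {group gT})
    (Gs_first : Gs 0 :=: 1%g) (Gs_last : Gs n.+1 :=: G)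
    (Gs_chain : forall i, i <= n -> (Gs i <| Gs i.+1)%g)
    (Gs_normal : forall i, i <= n.+1 -> (Gs i <| G)%g) :
  let k := num_pfactors p Gs n in
  (forall (d : nat) (rE : mx_representation F (G / Gs n)%G d),
      mx_irreducible rE ->
    forall c : nat,
      is_cartan_number (infl_repr (Gs_normal n (leqnSn n)) rE) c ->
    k + 1 <= c)
  /\ ((p.-group (G / Gs n))%g ->
      forall c : nat, is_cartan_number (triv_repr F G) c ->
      #|(G / Gs n)%g| + k - 1 <= c).
Proof.
have subG i : i <= n -> Gs i \subset Gs i.+1 by move/Gs_chain/normal_sub.
have nsG i : i <= n -> (Gs i <| G)%g by move/leqW/Gs_normal.
rewrite /= num_pfactorsE; split.
  move=> d rE irrE c [m [rP [f [covP [U [compU [lastU ->]]]]]]].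
  have absE := splitG _ _ (infl_repr_irr (Gs_normal n (leqnSn n)) irrE).
  (* If the top factor is a p-group it may count in k, but then G itself acts trivially on E, since
     the p-core acts trivially on simple modules; the series is used up to G. Otherwise the top
     factor does not count and the series stops at [Gs n]. *)
  have [pQ|npQ] := boolP (p.-group (Gs n.+1 / Gs n))%g.
    apply: (multiplicity_ge_pfactors compU charFp covP absE lastU Gs_normal)
      => [i|x].
      by rewrite ltnS => /subG.
    rewrite Gs_last => Gx; rewrite Gs_last in pQ.
    have := pcore_sub_rker_mx_irr_pchar charFp irrE.
    rewrite pcore_pgroup_id // => /subsetP/(_ _ (mem_quotient (Gs n) Gx)).
    by case/rkerP.
  rewrite big_mkcond big_ord_recr /= -big_mkcond (negPf npQ) /= addn0.
  apply: (multiplicity_ge_pfactors compU charFp covP absE lastU nsG).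
    by move=> i /ltnW/subG.
  by move=> x Nx; rewrite /= coset_id // repr_mx1.
move=> pQ c [m [rP [f [covP [U [compU [lastU ->]]]]]]].
apply: leq_trans (multiplicity_triv_ge compU charFp covP lastU nsG
  (fun i lt_i => subG i (ltnW lt_i)) pQ).
(* The series now stops at [Gs n]; the top factor adds at most one to k, and the [- 1] compensates
   for it. *)
rewrite [X in X - 1]addnC big_mkcond big_ord_recr /= -big_mkcond.
case: ifP => _; last by rewrite addn0 leq_subr.
by rewrite addnAC addnK.
Qed.
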